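(* Let $\varepsilon>0$. For almost all square-free rational integers $D>0$, the number of non-equivalent, additively indecomposable binary quadratic forms over $\mathcal{O}_{\mathbb{Q}(\sqrt{D})}$ is at least $\frac12 D^{\frac1{12}-\varepsilon}$.
   Context: ''Almost all'' means that the set of such $D$ has natural density $1$ among all square-free $D>0$. $\mathcal{O}_K$ denotes the ring of integers of $K=\mathbb{Q}(\sqrt{D})$. A binary quadratic form over $\mathcal{O}_K$ is $Q(x,y)=ax^2+bxy+cy^2$ with $a,b,c\in\mathcal{O}_K$; its Gram matrix is $M_Q=\begin{pmatrix} a & b/2 \\ b/2 & c \end{pmatrix}$. For $\alpha\in K$, $\alpha\succeq 0$ means $\sigma(\alpha)\geq0$ for every embedding $\sigma:K\to\mathbb{R}$. $Q$ is totally positive semi-definite if $Q(v)\succeq0$ for all $v\in K^2$, and totally positive definite if moreover $Q(v)=0$ implies $v=0$. A totally positive definite binary form $Q$ over $\mathcal{O}_K$ is additively indecomposable if it cannot be written as $Q=Q_1+Q_2$ with $Q_1,Q_2$ nonzero totally positive semi-definite binary quadratic forms over $\mathcal{O}_K$. Two forms $Q,H$ are equivalent if $M_H=NM_QN^t$ for some $N\in\mathcal{O}_K^{2\times2}$ with $\det N\in\mathcal{O}_K^\times$. *)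

(* Defs.v *)
From HB Require Import structures.
From mathcomp Require Import all_boot all_order all_algebra.
From mathcomp Require Import all_classical all_reals all_analysis.
From mathcomp Require Import ring.

Set Implicit Arguments.
Unset Strict Implicit.
Unset Printing Implicit Defensive.

Import Order.TTheory GRing.Theory Num.Theory.
Import numFieldNormedType.Exports.

Local Open Scope classical_set_scope.
Local Open Scope ring_scope.

Section QuadraticField.
Variables (R : realType) (D : nat).

(* Q(sqrt D) is realized inside R; its abstract embeddings into R are the
   terms of type {rmorphism quadfield R D -> R}. *)
Definition in_quadfield : {pred R} := fun x : R =>
  `[< exists a b : rat, x = ratr a + ratr b * Num.sqrt (D%:R : R) >].

Lemma in_quadfieldP (x : R) :
  reflect (exists a b : rat, x = ratr a + ratr b * Num.sqrt (D%:R : R))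
          (x \in in_quadfield).
Proof. exact: asboolP. Qed.

Lemma sqr_sqrtD : Num.sqrt (D%:R : R) ^+ 2 = D%:R.
Proof. by rewrite sqr_sqrtr ?ler0n. Qed.

Lemma in_quadfieldM : {in in_quadfield &, forall x y, x * y \in in_quadfield}.
Proof.
move=> x y /in_quadfieldP[a [b ->]] /in_quadfieldP[c [d ->]].
apply/in_quadfieldP; exists (a * c + b * d * D%:R), (a * d + b * c).
have := sqr_sqrtD; set s := Num.sqrt _ => sE.
rewrite !rmorphD !rmorphM /= ratr_nat -sE; ring.
Qed.

Lemma in_quadfieldV : {in in_quadfield, forall x, x^-1 \in in_quadfield}.
Proof.
move=> x xK; have /in_quadfieldP[a [b xE]] := xK.
have ratK (q : rat) : ratr q \in in_quadfield.
  by apply/in_quadfieldP; exists q, 0; rewrite rmorph0 mul0r addr0.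
have := sqr_sqrtD; set s := Num.sqrt _ in xE * => sE.
have [conj0|conj_neq0] := eqVneq (ratr a - ratr b * s) 0.
  have -> : x = ratr (a + a).
    by rewrite xE rmorphD /=; congr (_ + _); apply/esym/eqP; rewrite -subr_eq0 conj0.
  by rewrite -fmorphV; apply: ratK.
have [->|x_neq0] := eqVneq x 0; first by rewrite invr0 -[0](rmorph0 (@ratr R)); apply: ratK.
have normE : ratr (a * a - b * b * D%:R) = x * (ratr a - ratr b * s).
  rewrite rmorphB !rmorphM /= ratr_nat -sE xE; ring.
have -> : x^-1 = (ratr a - ratr b * s) * ratr (a * a - b * b * D%:R)^-1.
  by rewrite fmorphV /= normE invfM mulrCA mulfV ?mulr1.
apply: in_quadfieldM; last exact: ratK.
by apply/in_quadfieldP; exists a, (- b); rewrite rmorphN mulNr.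
Qed.

Lemma in_quadfield_divring_closed : divring_closed in_quadfield.
Proof.
split.
- by apply/in_quadfieldP; exists 1, 0; rewrite rmorph1 rmorph0 mul0r addr0.
- move=> x y /in_quadfieldP[a [b ->]] /in_quadfieldP[c [d ->]].
  by apply/in_quadfieldP; exists (a - c), (b - d); rewrite !rmorphB /=; ring.
- by move=> x y xK yK; apply: in_quadfieldM => //; apply: in_quadfieldV.
Qed.

HB.instance Definition _ :=
  GRing.isDivringClosed.Build R in_quadfield in_quadfield_divring_closed.

Record quadfield := QuadField
  { quadfield_val :> R; _ : quadfield_val \in in_quadfield }.

HB.instance Definition _ := [isSub for quadfield_val].
HB.instance Definition _ := [Choice of quadfield by <:].
HB.instance Definition _ := [SubChoice_isSubIntegralDomain of quadfield by <:].
HB.instance Definition _ := [SubIntegralDomain_isSubField of quadfield by <:].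

Definition in_quadint : {pred quadfield} := fun x : quadfield =>
  `[< integralOver (intr : int -> quadfield) x >].

Lemma in_quadintP (x : quadfield) :
  reflect (integralOver (intr : int -> quadfield) x) (x \in in_quadint).
Proof. exact: asboolP. Qed.

Lemma in_quadint_subring_closed : subring_closed in_quadint.
Proof.
split.
- exact/in_quadintP/integral1.
- by move=> x y /in_quadintP xO /in_quadintP yO; apply/in_quadintP/integral_sub.
- by move=> x y /in_quadintP xO /in_quadintP yO; apply/in_quadintP/integral_mul.
Qed.

HB.instance Definition _ :=
  GRing.isSubringClosed.Build quadfield in_quadint in_quadint_subring_closed.

Record quadint := QuadInt
  { quadint_val :> quadfield; _ : quadint_val \in in_quadint }.

HB.instance Definition _ := [isSub for quadint_val].
HB.instance Definition _ := [Choice of quadint by <:].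
HB.instance Definition _ := [SubChoice_isSubComNzRing of quadint by <:].

Definition quadint_unit : {pred quadint} := fun x : quadint =>
  `[< exists y : quadint, y * x = 1 >].

Definition quadint_inv (x : quadint) : quadint :=
  if pselect (exists y : quadint, y * x = 1) is left xU then sval (cid xU) else x.

Lemma quadint_mulVx : {in quadint_unit, left_inverse 1 quadint_inv *%R}.
Proof.
move=> x /asboolP xU; rewrite /quadint_inv.
by case: pselect => // yU; case: cid.
Qed.

Lemma quadint_unitPl (x y : quadint) : y * x = 1 -> quadint_unit x.
Proof. by move=> yx1; apply/asboolP; exists y. Qed.

Lemma quadint_inv_out : {in [predC quadint_unit], quadint_inv =1 id}.
Proof.
move=> x /asboolP xNU; rewrite /quadint_inv.
by case: pselect.
Qed.

HB.instance Definition _ := GRing.ComNzRing_hasMulInverse.Build quadint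
  quadint_mulVx quadint_unitPl quadint_inv_out.

(* (a, b, c) encodes a x^2 + b x y + c y^2; sums of forms are sums of triples. *)
Definition binform : Type := (quadint * quadint * quadint)%type.

Definition bf_eval (Q : binform) (x y : quadfield) : quadfield :=
  let: (a, b, c) := Q in
  quadint_val a * x ^+ 2 + quadint_val b * x * y + quadint_val c * y ^+ 2.

Definition gram (Q : binform) : 'M[quadfield]_2 :=
  let: (a, b, c) := Q in
  \matrix_(i < 2, j < 2)
    if i == j then (if i == 0 then quadint_val a else quadint_val c)
    else quadint_val b / 2.

Definition totally_nonneg (x : quadfield) : Prop :=
  forall sigma : {rmorphism quadfield -> R}, 0 <= sigma x.

Definition tot_pos_semidef (Q : binform) : Prop :=
  forall x y : quadfield, totally_nonneg (bf_eval Q x y).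

Definition tot_pos_def (Q : binform) : Prop :=
  tot_pos_semidef Q /\
  forall x y : quadfield, bf_eval Q x y = 0 -> x = 0 /\ y = 0.

Definition add_indecomposable (Q : binform) : Prop :=
  tot_pos_def Q /\
  ~ exists Q1 Q2 : binform,
      [/\ Q1 <> 0, Q2 <> 0, tot_pos_semidef Q1, tot_pos_semidef Q2
        & Q = Q1 + Q2].

Definition bf_equiv (Q H : binform) : Prop :=
  exists2 N : 'M[quadint]_2, \det N \is a GRing.unit &
    gram H = map_mx quadint_val N *m gram Q *m (map_mx quadint_val N)^T.

Definition indecomposable_classes : set (set binform) :=
  [set [set H | bf_equiv Q H] | Q in [set Q | add_indecomposable Q]].

Definition num_indecomposable : \bar R := counting indecomposable_classes.

End QuadraticField.

Definition squarefree (n : nat) : bool :=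
  (0 < n)%N && [forall d : 'I_n.+1, (d ^ 2 %| n)%N ==> (d == 1%N :> nat)].

(* The set of square-free D > 0 satisfying P has natural density 1 among all
   square-free D > 0; the quotient is x / 0 = 0 at N = 0 only. *)
Definition almost_all_squarefree (R : realType) (P : nat -> Prop) : Prop :=
  (fun N : nat =>
     (\sum_(1 <= n < N.+1 | squarefree n && `[< P n >]) 1)%N%:R /
     (\sum_(1 <= n < N.+1 | squarefree n) 1)%N%:R : R) @ \oo --> (1 : R).

(* Main.v *)
Require Import Defs.
From HB Require Import structures.
From mathcomp Require Import all_boot all_order all_algebra all_field.
From mathcomp Require Import all_classical all_reals all_analysis.
From mathcomp Require Import ring lra zify.

Set Implicit Arguments.
Unset Strict Implicit.
Unset Printing Implicit Defensive.

Import Order.TTheory GRing.Theory Num.Theory.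
Import numFieldNormedType.Exports.
Local Open Scope ring_scope.

(** The lower bound holds for every square-free D that is large enough, with
    far more room than required: a family of about D^(1/4) classes is exhibited,
    and natural density one follows because there are infinitely many
    square-free numbers.

    Let beta be an irrational algebraic integer of K = Q(sqrt D) of least
    possible house, the house being the larger of the absolute values of the two
    conjugates: beta = (1 + sqrt D)/2 if D is 1 modulo 4 and beta = sqrt D
    otherwise, so that sqrt D / 2 <= beta <= sqrt D. Consider the forms
    Q = a x^2 + beta x y + c y^2 with a, c positive rational integers below
    sqrt D. Suppose Q = Q1 + Q2 with both summands positive semi-definite. An
    algebraic integer lying between 0 and a in both embeddings is rational when
    a < sqrt D, so the outer coefficients of Q1 and Q2 are rational integers. One
    of the middle coefficients, say b1, is irrational. Semi-definiteness of
    a1 x^2 + b1 x y + c1 y^2 in both embeddings says that 4 a1 c1 bounds the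
    squared house of b1, hence 4 a1 c1 >= beta^2. If now the pair (a, c) is a
    minimal one with 4 a c > beta^2, then a1 = a and c1 = c, which leaves nothing
    for Q2. So Q is indecomposable ([minimal_form_indecomposable]).

    Equivalence multiplies the determinant a c - beta^2/4 by the square of a
    unit, and the norm of a unit is 1 or -1, so the norm of the determinant is a
    class invariant. It increases with a c, hence different values of a c
    give inequivalent forms.

    Taking a = k + j, c = k - j turns minimality of (a, c) into the statement
    that j^2 lies in a window of length about k below k^2 - beta^2/4. With k
    about beta/2 + 2 this quantity has order k, so its square root has order
    sqrt k, and the window contains about sqrt k squares
    ([exists_square_window]). *)

(** * Integrality over the integers *)

Lemma int_of_integral_ratr (F : numFieldType) (r : rat) :
  integralOver (intr : int -> F) (ratr r) -> r \is a Num.int.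
Proof.
case=> p p_mon pr0.
(* Integrality over the integers does not depend on the field in which it is
   tested, which makes the theory of algebraic integers in algC available. *)
have mapE (E : numFieldType) :
    map_poly (intr : int -> E) p = map_poly ratr (map_poly (intr : int -> rat) p).
  by rewrite -map_poly_comp; apply: eq_map_poly => z /=; rewrite ratr_int.
move: pr0; rewrite mapE fmorph_root => pr0.
rewrite -Cint_rat; apply: Cint_rat_Aint; first exact: Crat_rat.
apply: (@root_monic_Aint (map_poly intr p)); first by rewrite mapE fmorph_root.
  exact: monic_map.
by apply/polyOverP => i; rewrite coef_map /= intr_int.
Qed.

Lemma integral_quadratic (F : comNzRingType) (x : F) (b c : int) :
  x ^+ 2 + b%:~R * x + c%:~R = 0 -> integralOver (intr : int -> F) x.
Proof.
move=> xE; pose p : {poly int} := Poly [:: c; b; 1].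
have pE : p = [:: c; b; 1] :> seq int by rewrite (@PolyK _ 0).
exists p; first by rewrite monicE lead_coefE pE.
rewrite /root map_polyE pE horner_Poly /=.
by apply/eqP; rewrite -[RHS]xE mulr1z; ring.
Qed.

(** * Square-free integers *)

Lemma squarefree_sqr_dvdn (D d : nat) : squarefree D -> (d ^ 2 %| D)%N -> d = 1%N.
Proof.
case/andP=> D_gt0 /forallP sqD dD.
have d_le : (d < D.+1)%N by have := dvdn_leq D_gt0 dD; rewrite ltnS; nia.
by have /implyP/(_ dD)/eqP := sqD (Ordinal d_le).
Qed.

(** A denominator d of t would contribute d^2 to the denominator of t^2, which a
    square-free factor cannot cancel. *)
Lemma squarefree_int_sqrM (D : nat) (t : rat) :
  squarefree D -> t ^+ 2 * D%:R \is a Num.int -> t \is a Num.int.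
Proof.
move=> sqD /intrP[k tDk]; rewrite Qint_def.
have d_neq0 : (denq t)%:~R != 0 :> rat by rewrite intr_eq0 denq_neq0.
have tE : t * (denq t)%:~R = (numq t)%:~R by rewrite -{1}[t]divq_num_den divfK.
have eqZ : numq t ^+ 2 * D%:Z = k * denq t ^+ 2.
  apply: (@intr_inj rat); rewrite !rmorphM /= -tDk -pmulrn.
  by rewrite -tE; ring.
have dvd_d : (`|denq t| ^ 2 %| D)%N.
  rewrite -(@Gauss_dvdr _ (`|numq t| ^ 2)).
    apply/dvdnP; exists `|k|%N.
    by have /(congr1 absz) := eqZ; rewrite abszM [in RHS]abszM !abszX.
  by rewrite coprimeXl // coprimeXr // coprime_sym coprime_num_den.
by rewrite -absz_denq (squarefree_sqr_dvdn sqD dvd_d).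
Qed.

Lemma squarefree1 : squarefree 1.
Proof. by apply/forallP => -[[|[|d]]]. Qed.

Lemma squarefree_sqrt_irrational (R : rcfType) (D : nat) (r : rat) :
  squarefree D -> (1 < D)%N -> ratr r != Num.sqrt (D%:R : R).
Proof.
move=> sqD D_gt1; apply/eqP => rE.
have r2 : r ^+ 2 = D%:R.
  apply: (@fmorph_inj _ R ratr).
  by rewrite rmorphXn /= rE sqr_sqrtr ?ler0n // ratr_nat.
have /intrP[m mE] : r \is a Num.int.
  by apply: (squarefree_int_sqrM squarefree1); rewrite mulr1 r2 natr_int.
have D_sq : (`|m| ^ 2)%N = D.
  have /(congr1 absz) : m ^+ 2 = D%:Z.
    by apply: (@intr_inj rat); rewrite rmorphXn /= -mE r2.
  by rewrite abszX absz_nat.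
have := squarefree_sqr_dvdn sqD (d := `|m|%N); rewrite D_sq => /(_ (dvdnn _)) m1.
by rewrite -D_sq m1 in D_gt1.
Qed.

Lemma squarefree_prime (p : nat) : prime p -> squarefree p.
Proof.
move=> p_prime; rewrite /squarefree prime_gt0 //=; apply/forallP => d.
apply/implyP => d2p; have d_dvd : (d %| p)%N by apply: dvdn_trans d2p; rewrite dvdn_exp.
move/primeP: p_prime => [p_gt1 /(_ d d_dvd) /orP[//|/eqP dp]].
have := dvdn_leq (ltnW p_gt1) d2p; rewrite dp.
by move: p_gt1; clear; nia.
Qed.

(** * The field Q(sqrt D) and its two real embeddings *)

Section TwoEmbeddings.
Variables (R : realType) (D : nat).

Local Notation s := (Num.sqrt (D%:R : R)).
Local Notation K := (quadfield R D).

Lemma sqrtD_in : s \in @in_quadfield R D.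
Proof. by apply/in_quadfieldP; exists 0, 1; rewrite rmorph0 rmorph1 add0r mul1r. Qed.

Definition sqrtD : K := QuadField sqrtD_in.

Lemma quadfield_coord (x : K) : exists r t : rat, x = ratr r + ratr t * sqrtD.
Proof.
have /in_quadfieldP[r [t xE]] := valP x.
have ratrE (q : rat) := fmorph_rat (val : {rmorphism K -> R}) q.
exists r, t; apply: val_inj; rewrite [LHS]xE rmorphD rmorphM.
by congr (_ + _ * _); rewrite [RHS]ratrE.
Qed.

Lemma sqrtD_sqr : sqrtD ^+ 2 = D%:R.
Proof.
apply: val_inj; rewrite rmorphXn /= sqr_sqrtD.
exact/esym/(rmorph_nat (val : {rmorphism K -> R})).
Qed.

Lemma embed_coord (sigma : {rmorphism K -> R}) (r t : rat) :
  sigma (ratr r + ratr t * sqrtD) = ratr r + ratr t * sigma sqrtD.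
Proof.
rewrite rmorphD; congr (_ + _); first exact: fmorph_rat.
by rewrite [LHS]rmorphM; congr (_ * _); apply: fmorph_rat.
Qed.

Lemma embed_sqrtD (sigma : {rmorphism K -> R}) :
  sigma sqrtD = s \/ sigma sqrtD = - s.
Proof.
have /eqP : sigma sqrtD ^+ 2 = s ^+ 2.
  by rewrite -rmorphXn sqrtD_sqr rmorph_nat sqr_sqrtD.
by rewrite eqf_sqr => /orP[] /eqP; [left|right].
Qed.

Hypotheses (sqD : squarefree D) (D_gt1 : (1 < D)%N).

Lemma coord_inj (r t r' t' : rat) :
  ratr r + ratr t * s = ratr r' + ratr t' * s -> r = r' /\ t = t'.
Proof.
move=> E; have {E} E : ratr (t - t') * s = ratr (r' - r).
  by rewrite !rmorphB /=; lra.
have [/eqP|tt'] := eqVneq (t - t') 0.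
  rewrite subr_eq0 => /eqP tt'; split=> //.
  move/eqP: E; rewrite tt' subrr rmorph0 mul0r eq_sym fmorph_eq0 subr_eq0.
  by move/eqP.
have := squarefree_sqrt_irrational R ((r' - r) / (t - t')) sqD D_gt1.
rewrite fmorph_div /= -E mulrC mulKf ?eqxx // fmorph_eq0 //.
Qed.

(** The coordinates of an element on 1 and sqrt D are unique, so that changing
    the sign of the second one is a well-defined ring morphism. *)
Lemma exists_conjugation :
  exists sigma : {rmorphism K -> R}, sigma sqrtD = - s.
Proof.
have coordP (x : K) : {rt : rat * rat | val x = ratr rt.1 + ratr rt.2 * s}.
  by apply: cid; have /in_quadfieldP[r [t xE]] := valP x; exists (r, t).
pose f (x : K) : R := let rt := sval (coordP x) in ratr rt.1 - ratr rt.2 * s.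
have fE (x : K) (r t : rat) : val x = ratr r + ratr t * s -> f x = ratr r - ratr t * s.
  by move=> xE; have := esym xE; rewrite (svalP (coordP x)) => /coord_inj[-> ->].
have fB : zmod_morphism f.
  move=> x y; have /in_quadfieldP[a [b xE]] := valP x.
  have /in_quadfieldP[c [d yE]] := valP y.
  rewrite (fE x a b) // (fE y c d) // (fE _ (a - c) (b - d)).
    by rewrite !rmorphB /=; ring.
  by rewrite rmorphB /= xE yE !rmorphB /=; ring.
have fM : monoid_morphism f.
  split; first by rewrite (fE _ 1 0) ?rmorph1 ?rmorph0 /= mul0r ?subr0 ?addr0.
  move=> x y; have /in_quadfieldP[a [b xE]] := valP x.
  have /in_quadfieldP[c [d yE]] := valP y.
  rewrite (fE x a b) // (fE y c d) //.
  rewrite (fE _ (a * c + b * d * D%:R) (a * d + b * c)).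
    rewrite !rmorphD !rmorphM /= ratr_nat; have := sqr_sqrtD R D.
    by set u := Num.sqrt _ => <-; ring.
  rewrite rmorphM /= xE yE !rmorphD !rmorphM /= ratr_nat; have := sqr_sqrtD R D.
  by set u := Num.sqrt _ => <-; ring.
pose fA := GRing.isZmodMorphism.Build K R f fB.
pose fMM := GRing.isMonoidMorphism.Build K R f fM.
pose sigma : {rmorphism K -> R} := HB.pack f fA fMM.
exists sigma; rewrite [LHS](fE _ 0 1) ?rmorph0 ?rmorph1 ?mul1r ?add0r ?sub0r //.
Qed.

End TwoEmbeddings.

(** * Algebraic integers of Q(sqrt D) *)

Lemma house_sqr (R : realDomainType) (u v w : R) :
  (`|u| + `|v| * w) ^+ 2 = (u + v * w) ^+ 2
  \/ (`|u| + `|v| * w) ^+ 2 = (u - v * w) ^+ 2.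
Proof.
by case: (ger0P u); case: (ger0P v) => _ _; [left|right|right|left]; ring.
Qed.

Section QuadraticIntegersAndForms.
Variables (R : realType) (D : nat).
Hypotheses (sqD : squarefree D) (D_gt1 : (1 < D)%N).

Local Notation s := (Num.sqrt (D%:R : R)).
Local Notation K := (quadfield R D).
Local Notation O := (quadint R D).

Variables inclusion conj : {rmorphism K -> R}.
Hypothesis inclusion_sqrtD : inclusion (sqrtD R D) = s.
Hypothesis conj_sqrtD : conj (sqrtD R D) = - s.

Lemma s_gt0 : 0 < s.
Proof. by rewrite sqrtr_gt0 ltr0n ltnW. Qed.

Lemma embedding_cases (sigma : {rmorphism K -> R}) :
  sigma =1 inclusion \/ sigma =1 conj.
Proof.
have [sE|sE] := embed_sqrtD sigma; [left|right] => x.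
  by have [r [t ->]] := quadfield_coord x; rewrite !embed_coord sE inclusion_sqrtD.
by have [r [t ->]] := quadfield_coord x; rewrite !embed_coord sE conj_sqrtD.
Qed.

(** Write z = r + t sqrt D with r and t rational. The trace 2 r and the norm
    r^2 - t^2 D are rational algebraic integers, hence integers. So (2 t)^2 D is
    an integer, and 2 t is one as well because D is square-free. *)
Lemma quadint_coord (z : O) : exists u v : int,
  [/\ inclusion (val z) = (u%:~R + v%:~R * s) / 2,
      conj (val z) = (u%:~R - v%:~R * s) / 2
    & exists n : int, u ^+ 2 - D%:Z * v ^+ 2 = 4 * n].
Proof.
have [r [t zE]] := quadfield_coord (val z).
have zI : inclusion (val z) = ratr r + ratr t * s by rewrite zE embed_coord inclusion_sqrtD.
have zC : conj (val z) = ratr r - ratr t * s by rewrite zE embed_coord conj_sqrtD mulrN.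
have integral_embed (sigma : {rmorphism K -> R}) :
    integralOver (intr : int -> R) (sigma (val z)).
  have /in_quadintP/(integral_rmorph sigma)[p p_mon pz] := valP z.
  exists p => //; move: pz; congr (root _ _); apply: eq_map_poly => i /=.
  exact: rmorph_int.
have trI : 2 * r \is a Num.int.
  apply: (@int_of_integral_ratr R).
  have -> : ratr (2 * r) = inclusion (val z) + conj (val z).
    by rewrite zI zC rmorphM /= ratr_nat; ring.
  exact: (@integral_add _ _ intr).
have nmI : r ^+ 2 - t ^+ 2 * D%:R \is a Num.int.
  apply: (@int_of_integral_ratr R).
  have -> : ratr (r ^+ 2 - t ^+ 2 * D%:R) = inclusion (val z) * conj (val z).
    rewrite zI zC rmorphB !rmorphM /= ratr_nat; have := @sqr_sqrtD R D.
    by set w := Num.sqrt _ => <-; ring.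
  exact: (@integral_mul _ _ intr).
have t2I : 2 * t \is a Num.int.
  apply: (squarefree_int_sqrM sqD).
  have -> : (2 * t) ^+ 2 * D%:R = (2 * r) ^+ 2 - 4 * (r ^+ 2 - t ^+ 2 * D%:R).
    by ring.
  by apply: rpredB; [apply: rpredX | apply: rpredM => //; apply: natr_int].
move: trI t2I nmI => /intrP[u uE] /intrP[v vE] /intrP[n nE].
exists u, v; split.
- by rewrite zI -(ratr_int R u) -(ratr_int R v) -uE -vE !rmorphM /= ratr_nat; field.
- by rewrite zC -(ratr_int R u) -(ratr_int R v) -uE -vE !rmorphM /= ratr_nat; field.
exists n; apply: (@intr_inj rat).
rewrite rmorphB !rmorphM /= -nE -uE -vE -pmulrn; ring.
Qed.

Lemma fixed_quadint (z : O) :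
  inclusion (val z) = conj (val z) -> exists m : int, val z = m%:~R.
Proof.
have [u [v [zI zC [n uvn]]]] := quadint_coord z; rewrite zI zC => fixz.
have v0 : v = 0.
  apply/eqP; rewrite -(intr_eq0 R).
  have : v%:~R * s = 0 by lra.
  by move/eqP; rewrite mulf_eq0 (gt_eqF s_gt0) orbF.
exists (u %/ 2)%Z.
have uE : u = (u %/ 2)%Z * 2.
  (* The remainder of u modulo 2 has a square divisible by 4, so it vanishes. *)
  have [k kE] : exists k, (u %% 2)%Z ^+ 2 = 4 * k.
    exists (n - (u %/ 2)%Z * u + (u %/ 2)%Z ^+ 2).
    have -> : (u %% 2)%Z = u - (u %/ 2)%Z * 2 by rewrite {2}(divz_eq u 2); ring.
    by rewrite !mulrDr -uvn v0; ring.
  by have := divz_eq u 2; have := @modz_ge0 u 2; have := @ltz_pmod u 2; nia.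
have zI' : inclusion (val z) = (u %/ 2)%Z%:~R.
  by rewrite zI v0 {1}uE intrM; field.
by apply: (fmorph_inj inclusion); rewrite zI' rmorph_int.
Qed.

(** An element is irrational when the two embeddings tell it apart from its
    conjugate. The first clause makes beta the conjugate of larger absolute
    value, so that its house is |b|; comparing squares avoids absolute
    values. *)
Definition minimal_irrational (beta : O) : Prop :=
  let b := inclusion (val beta) in
  [/\ conj (val beta) ^+ 2 <= b ^+ 2, b != conj (val beta)
    & forall z : O, inclusion (val z) != conj (val z) ->
        b ^+ 2 <= inclusion (val z) ^+ 2 \/ b ^+ 2 <= conj (val z) ^+ 2].

(** Write z = (u + v sqrt D)/2 with v <> 0; the house of z is
    (|u| + |v| sqrt D)/2. Since u^2 - D v^2 is divisible by 4 and D is square-free,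
    odd v is possible only when D is 1 modulo 4, and then u is odd as well. The
    least house is therefore attained at u = v = 1 in that case and at u = 0,
    v = 2 in the others. *)
Lemma exists_minimal_irrational : exists beta : O,
  s / 2 <= inclusion (val beta) <= s /\ minimal_irrational beta.
Proof.
have s_ge1 : 1 <= s by rewrite -{1}(@sqrtr1 R) ler_wsqrtr // ler1n ltnW.
have house_bound (h : R) (z : O) (u v : int) : 0 <= h ->
    inclusion (val z) = (u%:~R + v%:~R * s) / 2 ->
    conj (val z) = (u%:~R - v%:~R * s) / 2 ->
    h <= (`|u|%:~R + `|v|%:~R * s) / 2 ->
    h ^+ 2 <= inclusion (val z) ^+ 2 \/ h ^+ 2 <= conj (val z) ^+ 2.
  move=> h_ge0 zI zC h_le.
  have h2 : h ^+ 2 <= ((`|u|%:~R + `|v|%:~R * s) / 2) ^+ 2.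
    by rewrite ler_sqr ?nnegrE //; apply: le_trans h_le.
  move: h2; rewrite !intr_norm zI zC !expr_div_n.
  by have [->|->] := house_sqr u%:~R v%:~R s; [left|right].
have coord_neq0 (z : O) (u v : int) :
    inclusion (val z) = (u%:~R + v%:~R * s) / 2 ->
    conj (val z) = (u%:~R - v%:~R * s) / 2 ->
    inclusion (val z) != conj (val z) -> v != 0.
  by move=> -> ->; apply: contra_neq => ->; ring.
have [D1|D1] := eqVneq (D %% 4)%N 1%N.
- have [k kE] : exists k : nat, D = (k * 4 + 1)%N.
    by exists (D %/ 4)%N; rewrite {1}(divn_eq D 4) D1.
  have beta_int : (1 + sqrtD R D) / 2 \in in_quadint (R := R) (D := D).
    apply/in_quadintP; apply: (@integral_quadratic _ _ (- 1) (- k%:Z)).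
    have : (sqrtD R D) ^+ 2 = k%:R * 4 + 1 by rewrite sqrtD_sqr kE natrD natrM.
    rewrite !rmorphN /= -!pmulrn; set w := sqrtD _ _ => wE.
    transitivity ((w ^+ 2 - (k%:R * 4 + 1)) / 4).
      by field; rewrite -!(fmorph_eq0 inclusion) !rmorph_nat !pnatr_eq0.
    by rewrite wE subrr mul0r.
  exists (QuadInt beta_int); rewrite /minimal_irrational /=.
  have -> : inclusion ((1 + sqrtD R D) / 2) = (1 + s) / 2.
    by rewrite rmorphM fmorphV rmorphD rmorph1 rmorph_nat inclusion_sqrtD.
  have -> : conj ((1 + sqrtD R D) / 2) = (1 - s) / 2.
    by rewrite rmorphM fmorphV rmorphD rmorph1 rmorph_nat conj_sqrtD.
  split; [by lra | split; [by nra | by apply/eqP; lra |]].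
  move=> z irr_z; have [u [v [zI zC [n uvn]]]] := quadint_coord z.
  apply: (house_bound _ _ _ _ _ zI zC); first by lra.
  have v_neq0 := coord_neq0 _ _ _ zI zC irr_z.
  (* If v = 1 or v = -1, then u is odd since u^2 - D v^2 is divisible by 4. *)
  have large : (1 <= `|u|) && (1 <= `|v|) || (2 <= `|v|).
    have [u0|] := eqVneq u 0; last by lia.
    have [v1|] := eqVneq `|v| 1; last by lia.
    have v2 : v ^+ 2 = 1 by have [->|->] : v = 1 \/ v = -1 by lia.
    by move: uvn; rewrite u0 v2; lia.
  have u_ge0 : 0 <= `|u|%:~R :> R by rewrite ler0z.
  case/orP: large => [/andP[u1 v1]|v2].
    have {}u1 : 1 <= `|u|%:~R :> R by rewrite ler1z.
    have {}v1 : 1 <= `|v|%:~R :> R by rewrite ler1z.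
    by nra.
  by have {}v2 : 2 <= `|v|%:~R :> R; [rewrite (ler_int R 2) | nra].
- have beta_int : sqrtD R D \in in_quadint (R := R) (D := D).
    apply/in_quadintP; apply: (@integral_quadratic _ _ 0 (- D%:Z)).
    by rewrite sqrtD_sqr rmorphN /= -pmulrn mul0r addr0 subrr.
  exists (QuadInt beta_int); rewrite /minimal_irrational /=.
  rewrite inclusion_sqrtD conj_sqrtD; split; [by lra | split; [by nra | by apply/eqP; lra |]].
  move=> z irr_z; have [u [v [zI zC [n uvn]]]] := quadint_coord z.
  apply: (house_bound _ _ _ _ _ zI zC); first by lra.
  have v_neq0 := coord_neq0 _ _ _ zI zC irr_z.
  have v_ge2 : 2 <= `|v|%:~R :> R.
    rewrite (ler_int R 2) leNgt; apply/negP => v_lt2.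
    have v1 : v ^+ 2 = 1 by have [->|->] : v = 1 \/ v = -1 by lia.
    have D0 : (D %% 4 != 0)%N.
      by apply/negP => /(squarefree_sqr_dvdn sqD (d := 2)).
    move: uvn; rewrite v1 mulr1.
    have := divz_eq u 2; have := @modz_ge0 u 2; have := @ltz_pmod u 2.
    set q := (u %/ 2)%Z; set r := (u %% 2)%Z => r_lt2 r_ge0 uE uvn.
    move: uvn; rewrite uE; have [->|->] : r = 0 \/ r = 1 by lia.
      by have -> : (q * 2 + 0) ^+ 2 = 4 * q ^+ 2 by [ring]; lia.
    by have -> : (q * 2 + 1) ^+ 2 = 4 * (q ^+ 2 + q) + 1 by [ring]; lia.
  have u_ge0 : 0 <= `|u|%:~R :> R by rewrite ler0z.
  by nra.
Qed.

(** * Indecomposable forms *)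

(** The value of the form at (-b, 2 a) is a (4 a c - b^2), which gives the claim
    unless a vanishes; then the value at (-(c + 1), b) is - b^2. *)
Lemma semidef_disc (a b c : O) (sigma : {rmorphism K -> R}) :
  tot_pos_semidef (a, b, c) ->
  [/\ 0 <= sigma (val a), 0 <= sigma (val c)
    & sigma (val b) ^+ 2 <= 4 * sigma (val a) * sigma (val c)].
Proof.
move=> Q_ge0.
have evalE (x y : K) : 0 <= sigma (val a) * sigma x ^+ 2
    + sigma (val b) * sigma x * sigma y + sigma (val c) * sigma y ^+ 2.
  by have := Q_ge0 x y sigma; rewrite /= !rmorphD !rmorphM.
have a_ge0 : 0 <= sigma (val a).
  by have := evalE 1 0; rewrite rmorph1 rmorph0; lra.
have c_ge0 : 0 <= sigma (val c).
  by have := evalE 0 1; rewrite rmorph1 rmorph0; lra.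
split=> //.
have [a0|a_neq0] := eqVneq (sigma (val a)) 0.
  have := evalE (- (val c + 1)) (val b).
  by rewrite rmorphN rmorphD rmorph1 a0; nra.
have a_gt0 : 0 < sigma (val a) by rewrite lt_def a_neq0.
have := evalE (- val b) (2 * val a); rewrite rmorphN rmorphM rmorph_nat => ev.
by rewrite -subr_ge0 -(pmulr_rge0 _ a_gt0); lra.
Qed.

Lemma natO_val (sigma : {rmorphism K -> R}) (n : nat) :
  sigma (val (n%:R : O)) = n%:R.
Proof.
have -> : val (n%:R : O) = n%:R by exact: (rmorph_nat (val : {rmorphism O -> K})).
exact: rmorph_nat.
Qed.

(** If z = (u + v sqrt D)/2 had v <> 0, positivity of both conjugates of z would
    give u >= |v| sqrt D, and that of n - z would give 2 n - u >= |v| sqrt D,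
    so n would be at least sqrt D. *)
Lemma small_summand (z w : O) (n : nat) :
  (forall sigma : {rmorphism K -> R}, 0 <= sigma (val z)) ->
  (forall sigma : {rmorphism K -> R}, 0 <= sigma (val w)) ->
  z + w = n%:R -> n%:R < s -> exists2 m : int, val z = m%:~R & 0 <= m <= n%:Z.
Proof.
move=> z_ge0 w_ge0 zw n_lt.
have wE (sigma : {rmorphism K -> R}) : sigma (val w) = n%:R - sigma (val z).
  by rewrite -(natO_val sigma n) -zw !rmorphD /=; ring.
have [m zm] : exists m : int, val z = m%:~R.
  apply: fixed_quadint; have [u [v [zI zC _]]] := quadint_coord z.
  have := w_ge0 inclusion; have := w_ge0 conj.
  have := z_ge0 inclusion; have := z_ge0 conj; rewrite !wE zI zC => h1 h2 h3 h4.
  have [->|v_neq0] := eqVneq v 0; first by ring.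
  have [v_ge1|v_le1] : 1 <= v%:~R :> R \/ v%:~R <= - 1 :> R.
    have [|] : 1 <= v \/ v <= - 1 by lia.
      by left; rewrite (ler_int R 1).
    by right; rewrite (ler_int R _ (- 1)).
    by nra.
  by nra.
exists m => //; have := z_ge0 inclusion; have := w_ge0 inclusion.
by rewrite wE zm rmorph_int subr_ge0 (ler_int R _ n%:Z) ler0z => -> ->.
Qed.

Lemma ltz_nat_pred (F : realFieldType) (m : int) (n : nat) :
  m < n%:Z -> m%:~R <= n%:R - 1 :> F.
Proof. by rewrite -lezD1 -(ler_int F) intrD -pmulrn; lra. Qed.

Section MinimalForms.
Variable beta : O.
Local Notation b := (inclusion (val beta)).
Hypothesis beta_min : minimal_irrational beta.
Variables a c : nat.
Hypotheses (a_small : a%:R < s) (c_small : c%:R < s).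
Hypotheses (ac_gt : b ^+ 2 < 4 * a%:R * c%:R)
  (a_min : 4 * (a%:R - 1) * c%:R < b ^+ 2)
  (c_min : 4 * a%:R * (c%:R - 1) < b ^+ 2).

Definition minimal_form : binform R D := (a%:R, beta, c%:R).

Lemma embed_beta_sqr (sigma : {rmorphism K -> R}) :
  sigma (val beta) ^+ 2 <= b ^+ 2.
Proof. by have [house_beta _ _] := beta_min; have [->|->] := embedding_cases sigma. Qed.

Lemma a_gt0 : 0 < a%:R :> R.
Proof. by rewrite lt_def ler0n andbT; apply/eqP => a0; move: ac_gt; rewrite a0; nra. Qed.

Lemma minimal_form_square (sigma : {rmorphism K -> R}) (x y : K) :
  4 * a%:R * sigma (bf_eval minimal_form x y) =
    (2 * a%:R * sigma x + sigma (val beta) * sigma y) ^+ 2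
    + (4 * a%:R * c%:R - sigma (val beta) ^+ 2) * sigma y ^+ 2.
Proof. by rewrite /= !rmorphD !rmorphM !natO_val; ring. Qed.

Lemma minimal_form_posdef : tot_pos_def minimal_form.
Proof.
have disc_gt0 (sigma : {rmorphism K -> R}) :
    0 < 4 * a%:R * c%:R - sigma (val beta) ^+ 2.
  by rewrite subr_gt0 (le_lt_trans (embed_beta_sqr sigma)).
split=> [x y sigma|x y Q0].
  have a4 : 0 < 4 * a%:R :> R by rewrite mulr_gt0 ?a_gt0.
  rewrite -(pmulr_rge0 _ a4) minimal_form_square addr_ge0 ?sqr_ge0 //.
  by rewrite mulr_ge0 ?sqr_ge0 ?ltW.
have := minimal_form_square inclusion x y; rewrite Q0 rmorph0 mulr0 => sum0.
have y0 : inclusion y = 0.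
  apply/eqP; rewrite -sqrf_eq0 eq_le sqr_ge0 andbT.
  rewrite -(pmulr_rle0 _ (disc_gt0 inclusion)).
  by have := sqr_ge0 (2 * a%:R * inclusion x + b * inclusion y); lra.
move: sum0; rewrite y0 expr0n mulr0 !addr0 mulr0 addr0 => /esym/eqP.
rewrite sqrf_eq0 mulf_eq0 mulf_eq0 !pnatr_eq0 /= -(pnatr_eq0 R) (gt_eqF a_gt0) /=.
by rewrite fmorph_eq0 => /eqP->; split=> //; apply/eqP; rewrite -(fmorph_eq0 inclusion) y0.
Qed.

(** The irrational middle coefficient b1 forces 4 a1 c1 >= beta^2, so by
    minimality of (a, c) the summand carrying it takes all of a and c. *)
Lemma irrational_summand_absorbs (a1 b1 c1 a2 b2 c2 : O) :
  tot_pos_semidef (a1, b1, c1) -> tot_pos_semidef (a2, b2, c2) ->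
  a1 + a2 = a%:R -> c1 + c2 = c%:R ->
  inclusion (val b1) != conj (val b1) -> [/\ a2 = 0, b2 = 0 & c2 = 0].
Proof.
move=> Q1_ge0 Q2_ge0 aE cE irr_b1.
have [_ _ min_beta] := beta_min.
have disc1 sigma := semidef_disc sigma Q1_ge0.
have disc2 sigma := semidef_disc sigma Q2_ge0.
have [m a1m /andP[m_ge0 m_le]] : exists2 m : int, val a1 = m%:~R & 0 <= m <= a%:Z.
  by apply: (@small_summand a1 a2) => // sigma; case: (disc1 sigma); case: (disc2 sigma).
have [k c1k /andP[k_ge0 k_le]] : exists2 k : int, val c1 = k%:~R & 0 <= k <= c%:Z.
  by apply: (@small_summand c1 c2) => // sigma; case: (disc1 sigma); case: (disc2 sigma).
have mk_ge : b ^+ 2 <= 4 * m%:~R * k%:~R.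
  have [h|h] := min_beta b1 irr_b1; apply: (le_trans h).
    by have [_ _] := disc1 inclusion; rewrite a1m c1k !rmorph_int.
  by have [_ _] := disc1 conj; rewrite a1m c1k !rmorph_int.
have mR : 0 <= m%:~R :> R by rewrite ler0z.
have kR : 0 <= k%:~R :> R by rewrite ler0z.
have mR_le : m%:~R <= a%:R :> R by rewrite (ler_int R _ a%:Z).
have kR_le : k%:~R <= c%:R :> R by rewrite (ler_int R _ c%:Z).
have ma : m = a.
  apply/eqP; rewrite eq_le m_le leNgt; apply/negP => m_lt.
  have mR_lt := ltz_nat_pred R m_lt.
  by move: a_min; nra.
have kc : k = c.
  apply/eqP; rewrite eq_le k_le leNgt; apply/negP => k_lt.
  have kR_lt := ltz_nat_pred R k_lt.
  by move: c_min; nra.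
have rest0 (z w : O) (n : nat) : val z = n%:R -> z + w = n%:R -> w = 0.
  move=> zn; have -> : z = n%:R.
    by apply: val_inj; rewrite zn; apply/esym/(rmorph_nat (val : {rmorphism O -> K})).
  by move/eqP; rewrite -subr_eq0 addrAC subrr add0r => /eqP.
have a20 : a2 = 0 by apply: rest0 aE; rewrite a1m ma.
have c20 : c2 = 0 by apply: rest0 cE; rewrite c1k kc.
split=> //; apply: val_inj; rewrite rmorph0; apply/eqP.
rewrite -(fmorph_eq0 inclusion) -sqrf_eq0 eq_le sqr_ge0 andbT.
have [_ _] := disc2 inclusion; rewrite a20 c20 !rmorph0.
by rewrite mulr0.
Qed.

(** The middle coefficients add up to the irrational beta, so that one of them is
    irrational and its summand exhausts the form. *)
Lemma minimal_form_indecomposable : add_indecomposable minimal_form.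
Proof.
split; first exact: minimal_form_posdef.
case=> -[[a1 b1] c1] [[[a2 b2] c2] [Q1_neq0 Q2_neq0 Q1_ge0 Q2_ge0 [aE bE cE]]].
have [fix1|irr1] := eqVneq (inclusion (val b1)) (conj (val b1)); last first.
  have [a0 b0 c0] := irrational_summand_absorbs Q1_ge0 Q2_ge0 (esym aE) (esym cE) irr1.
  by apply: Q2_neq0; rewrite a0 b0 c0.
have [fix2|irr2] := eqVneq (inclusion (val b2)) (conj (val b2)); last first.
  rewrite addrC in aE; rewrite addrC in cE.
  have [a0 b0 c0] := irrational_summand_absorbs Q2_ge0 Q1_ge0 (esym aE) (esym cE) irr2.
  by apply: Q1_neq0; rewrite a0 b0 c0.
have [_ /eqP irr_beta _] := beta_min; apply: irr_beta.
by rewrite bE rmorphD /= !rmorphD fix1 fix2.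
Qed.

End MinimalForms.

(** * The norm of the determinant as a class invariant *)

Definition conj_norm (x : K) : R := inclusion x * conj x.

Lemma conj_normM (x y : K) : conj_norm (x * y) = conj_norm x * conj_norm y.
Proof. by rewrite /conj_norm !rmorphM mulrACA. Qed.

Lemma conj_norm_int (z : O) : exists n : int, conj_norm (val z) = n%:~R.
Proof.
have [u [v [zI zC [n uvn]]]] := quadint_coord z; exists n.
have /(congr1 (intr : int -> R)) := uvn.
rewrite rmorphB !rmorphM /= -pmulrn /conj_norm zI zC.
have := @sqr_sqrtD R D; set w := Num.sqrt _ => <- h.
have -> : (u%:~R + v%:~R * w) / 2 * ((u%:~R - v%:~R * w) / 2) =
  (u%:~R * u%:~R - w ^+ 2 * (v%:~R * v%:~R)) / 4 by field.
by rewrite h; field.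
Qed.

Lemma conj_norm_unit (z : O) : z \is a GRing.unit -> conj_norm (val z) ^+ 2 = 1.
Proof.
move=> zU; have [n nE] := conj_norm_int z; have [m mE] := conj_norm_int z^-1.
have nm1 : n * m = 1.
  apply: (@intr_inj R); rewrite rmorphM /= -nE -mE -conj_normM.
  by rewrite -rmorphM divrr // /conj_norm !rmorph1 mulr1.
have /eqP : (`|n| * `|m| = 1)%N by rewrite -abszM nm1.
rewrite muln_eq1 => /andP[/eqP n1 _].
have [n_eq|n_eq] : n = 1 \/ n = -1 by move: n1; clear; lia.
  by rewrite nE n_eq expr1n.
by rewrite nE n_eq rmorphN sqrrN expr1n.
Qed.

Lemma det_mx2 (F : comPzRingType) (A : 'M[F]_2) :
  \det A = A 0 0 * A 1 1 - A 0 1 * A 1 0.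
Proof.
rewrite (expand_det_row _ 0) !big_ord_recl big_ord0 addr0 /cofactor !det_mx11 !mxE /=.
rewrite expr0 expr1 mul1r mulN1r mulrN; congr (_ * A _ _ - A _ _ * A _ _); exact: val_inj.
Qed.

Lemma det_gram (a b c : O) :
  \det (gram (a, b, c)) = val a * val c - (val b / 2) ^+ 2.
Proof. by rewrite det_mx2 !mxE /= expr2. Qed.

(** The determinant is multiplied by the square of the unit det N, and
    the norm of a unit has square 1. *)
Lemma bf_equiv_det_norm (Q H : binform R D) :
  bf_equiv Q H -> conj_norm (\det (gram H)) = conj_norm (\det (gram Q)).
Proof.
case=> N NU ->; rewrite !det_mulmx det_tr !conj_normM.
rewrite (det_map_mx (val : {rmorphism O -> K})) mulrAC -expr2.
by rewrite conj_norm_unit ?mul1r.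
Qed.

Lemma bf_equiv_refl (Q : binform R D) : bf_equiv Q Q.
Proof.
exists 1%:M; first by rewrite det1 unitr1.
by rewrite (map_mx1 (val : {rmorphism O -> K})) trmx1 mulmx1 mul1mx.
Qed.

Lemma bf_class_det_norm (Q H : binform R D) :
  [set X | bf_equiv Q X]%classic = [set X | bf_equiv H X]%classic ->
  conj_norm (\det (gram H)) = conj_norm (\det (gram Q)).
Proof.
move=> /(congr1 (fun C : set (binform R D) => C H)) /= E.
by apply: bf_equiv_det_norm; rewrite E; apply: bf_equiv_refl.
Qed.

(** The norm of 4 a c - beta^2 is (4 a c - b^2) (4 a c - b'^2), where b and b' are
    the conjugates of beta; both factors are positive and increase with a c. *)
Lemma minimal_form_det_inj (beta : O) (a c a' c' : nat) :
  conj (val beta) ^+ 2 <= inclusion (val beta) ^+ 2 ->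
  inclusion (val beta) ^+ 2 < 4 * a%:R * c%:R ->
  inclusion (val beta) ^+ 2 < 4 * a'%:R * c'%:R ->
  conj_norm (\det (gram (a%:R, beta, c%:R))) =
    conj_norm (\det (gram (a'%:R, beta, c'%:R))) ->
  (a * c = a' * c')%N.
Proof.
have det_embed (sigma : {rmorphism K -> R}) (n m : nat) :
    4 * sigma (\det (gram (n%:R, beta, m%:R)))
    = 4 * n%:R * m%:R - sigma (val beta) ^+ 2.
  rewrite det_gram rmorphB rmorphXn !rmorphM !natO_val fmorphV rmorph_nat.
  by field.
rewrite /conj_norm => house_beta ac ac' /(congr1 (fun x => 4 * 4 * x)).
rewrite [LHS]mulrACA [RHS]mulrACA !det_embed -!mulrA -!natrM.
rewrite -!mulrA -!natrM in ac ac'; set p := (a * c)%N in ac *; set q := (a' * c')%N in ac' *.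
set B := inclusion _ in house_beta ac ac' *; set B' := conj _ in house_beta *.
move=> E; apply/eqP; rewrite -(eqr_nat R) -subr_eq0.
have : (p%:R - q%:R) * (4 * p%:R + 4 * q%:R - B ^+ 2 - B' ^+ 2) = 0 by lra.
by move/eqP; rewrite mulf_eq0 => /orP[//|/eqP]; lra.
Qed.

End QuadraticIntegersAndForms.

(** * Squares in a short window *)

(** With S = k^2 - b^2/4, the two bounds on j say that S - k + j < j^2 < S. For
    k close to b/2 + 2 the number S lies between 2 k - 1 and 4 k - 4, so its square
    root is at most 2 sqrt k. Consecutive squares below S are then at most about
    4 sqrt k apart, and n of them fit into a window of length k as soon as
    sqrt k >= 4 (n + 2). The hypothesis on s guarantees this because k > s/4. *)
Lemma exists_square_window (R : realType) (s b : R) (n : nat) :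
  64 * (n%:R + 2) ^+ 2 <= s -> s / 2 <= b <= s ->
  exists k j0 : nat, forall j : nat, (j0 <= j < j0 + n)%N ->
    [/\ (j <= k)%N, k%:R + j%:R < s,
        b ^+ 2 < 4 * (k%:R ^+ 2 - j%:R ^+ 2)
      & 4 * (k%:R ^+ 2 - j%:R ^+ 2) - 4 * (k%:R - j%:R) < b ^+ 2].
Proof.
move=> s_large /andP[b_ge b_le].
have n_ge0 : 0 <= n%:R :> R := ler0n _ n.
have s_gt0 : 0 < s by nra.
have [r rE] : exists r, b = 2 * r by exists (b / 2); field.
have r_ge0 : 0 <= r by lra.
(* The witness k is the integer with k - 2 <= b/2 < k - 1. *)
have /andP[t_le t_gt] := truncn_itv r_ge0; set t := Num.truncn r in t_le t_gt.
pose k := (t + 2)%N; exists k.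
have kE : k%:R = t%:R + 2 :> R by rewrite natrD.
have t1E : t.+1%:R = t%:R + 1 :> R by rewrite -natr1.
rewrite t1E in t_gt.
have S_ge0 : 0 <= k%:R ^+ 2 - r ^+ 2 by nra.
set S := k%:R ^+ 2 - r ^+ 2 in S_ge0.
have /andP[m_le m_gt] := truncn_itv (sqrtr_ge0 S).
set m := Num.truncn _ in m_le m_gt.
have m1E : m.+1%:R = m%:R + 1 :> R by rewrite -natr1.
have m_ge0 : 0 <= m%:R :> R := ler0n _ m.
have m2_le : m%:R ^+ 2 <= S by rewrite -(sqr_sqrtr S_ge0) ler_sqr // nnegrE sqrtr_ge0.
have m2_gt : S < (m%:R + 1) ^+ 2.
  by rewrite -m1E -(sqr_sqrtr S_ge0) ltr_sqr // nnegrE ?sqrtr_ge0 ?ler0n.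
have S_le : S <= 4 * k%:R - 4 by rewrite /S; nra.
have S_gt : 2 * k%:R - 1 < S by rewrite /S; nra.
have k_large : 16 * (n%:R + 2) ^+ 2 <= k%:R :> R by lra.
have k_ge1 : 1 <= k%:R :> R by rewrite kE; have := ler0n R t; lra.
have m_large : n%:R + 1 <= m%:R :> R.
  have : (4 * (n%:R + 2)) ^+ 2 < (m%:R + 1) ^+ 2 :> R by lra.
  by rewrite ltr_sqr ?nnegrE; lra.
have nm_le : (2 * n%:R + 3) * m%:R <= k%:R :> R.
  rewrite -ler_sqr ?nnegrE; [|nra|lra].
  rewrite exprMn; apply: (@le_trans _ _ ((2 * n%:R + 3) ^+ 2 * (4 * k%:R))).
    by rewrite ler_wpM2l ?sqr_ge0 //; lra.
  by rewrite [leRHS]expr2 mulrA ler_wpM2r; nra.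
have nm : (n < m)%N by rewrite -(ltr_nat R); lra.
(* Here m^2 <= S < (m + 1)^2; the n integers below m are used. *)
exists (m - n)%N => j; rewrite subnK ?(ltnW nm) // => /andP[j_ge j_lt].
have jR_lt : j%:R + 1 <= m%:R :> R by rewrite natr1 ler_nat.
have jR_ge : m%:R - n%:R <= j%:R :> R by rewrite -natrB ?ler_nat // ltnW.
have n_ge1 : 1 <= n%:R :> R by rewrite ler1n; move: j_ge j_lt; clear; lia.
have jk : j%:R <= k%:R :> R by nra.
split.
- by rewrite -(ler_nat R).
- have m_lt : m%:R < s / 2 - 2 by rewrite -ltr_sqr ?nnegrE; nra.
  by lra.
- have : j%:R ^+ 2 < m%:R ^+ 2 :> R by rewrite ltr_sqr ?nnegrE; lra.
  by rewrite rE /S; move: m2_le; rewrite /S; nra.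
have : (m%:R - n%:R) ^+ 2 - (m%:R - n%:R) <= j%:R ^+ 2 - j%:R :> R.
  have : 0 <= (j%:R - (m%:R - n%:R)) * (j%:R + (m%:R - n%:R) - 1) :> R.
    by rewrite mulr_ge0; lra.
  by lra.
by move: m2_gt; rewrite rE /S; nra.
Qed.

(** * Counting classes *)

Lemma leq_counting (R : realType) (T : choiceType) (A : set T) (n : nat) (f : 'I_n -> T) :
  injective f -> (forall i, A (f i)) -> (n%:R%:E <= counting A :> \bar R)%E.
Proof.
move=> f_inj fA; rewrite /counting; case: ifPn => [/asboolP finA|_]; last exact: leey.
rewrite lee_fin ler_nat.
have := @uniq_leq_size _ (codom f) (finmap.enum_fset (fset_set A)).
rewrite size_codom card_ord; apply; first by rewrite map_inj_uniq ?enum_uniq.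
by move=> _ /codomP[i ->]; rewrite in_fset_set // inE.
Qed.

Lemma num_indecomposable_ge (R : realType) (D n : nat) :
  squarefree D -> 64 * (n%:R + 2) ^+ 2 <= Num.sqrt (D%:R : R) ->
  (n%:R%:E <= num_indecomposable R D)%E.
Proof.
move=> sqD s_large; have n_ge0 := ler0n R n.
have D_gt1 : (1 < D)%N.
  rewrite ltnNge; apply/negP => D_le1.
  have : Num.sqrt (D%:R : R) <= 1 by rewrite -{2}(@sqrtr1 R) ler_wsqrtr // lern1.
  by nra.
have [conj conjE] := exists_conjugation R sqD D_gt1.
pose inclusion : {rmorphism quadfield R D -> R} := val.
have inclE : inclusion (sqrtD R D) = Num.sqrt (D%:R : R) by [].
have [beta [b_itv beta_min]] := exists_minimal_irrational sqD D_gt1 inclE conjE.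
have [house_b _ _] := beta_min; set b := inclusion (val beta) in b_itv house_b.
have [k [j0 kj]] := exists_square_window s_large b_itv.
(* Minimality of (a, c) is the bound 4 a c - 4 c < b^2 since c <= a. *)
pose a (i : 'I_n) := (k + (j0 + i))%N; pose c (i : 'I_n) := (k - (j0 + i))%N.
have acP (i : 'I_n) : [/\ (j0 + i <= k)%N, (a i)%:R < Num.sqrt (D%:R : R),
    (c i)%:R < Num.sqrt (D%:R : R), b ^+ 2 < 4 * (a i)%:R * (c i)%:R &
    4 * (a i)%:R * (c i)%:R - 4 * (c i)%:R < b ^+ 2].
  have [|jk kj_lt ac_gt ac_lt] := kj (j0 + i)%N.
    by rewrite leq_addr ltn_add2l ltn_ord.
  have aE : (a i)%:R = k%:R + (j0 + i)%:R :> R by exact: natrD.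
  have cE : (c i)%:R = k%:R - (j0 + i)%:R :> R by exact: natrB.
  have j_ge0 := ler0n R (j0 + i); rewrite aE cE.
  by split=> //; lra.
pose class_of i := [set H | bf_equiv (minimal_form beta (a i) (c i)) H]%classic.
apply: (@leq_counting R _ _ _ class_of).
  move=> i i' /(bf_class_det_norm sqD inclE conjE) E.
  have [jk _ _ ac_gt _] := acP i; have [jk' _ _ ac_gt' _] := acP i'.
  have := minimal_form_det_inj house_b ac_gt' ac_gt E.
  rewrite /a /c ![((k + _) * _)%N]mulnC -!subn_sqr => sqr_eq; apply: val_inj => /=.
  have : ((j0 + i') ^ 2 = (j0 + i) ^ 2)%N by move: sqr_eq jk jk'; clear; nia.
  by move/eqP; rewrite eqn_exp2r // eqn_add2l => /eqP.
move=> i; exists (minimal_form beta (a i) (c i)) => //.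
have [jk a_small c_small ac_gt ac_lt] := acP i.
have ca : (c i)%:R <= (a i)%:R :> R by rewrite ler_nat (leq_trans (leq_subr _ _) (leq_addr _ _)).
by apply: (minimal_form_indecomposable sqD D_gt1 inclE conjE) => //; rewrite -/b; lra.
Qed.

Lemma powR_root_trunc (R : realType) (x : R) (k : nat) : 0 <= x -> (0 < k)%N ->
  exists n : nat, (n%:R ^+ k <= x) && (x < (n%:R + 1) ^+ k)
    && (x `^ k%:R^-1 < n%:R + 1).
Proof.
move=> x_ge0 k_gt0; pose y := x `^ k%:R^-1.
have y_ge0 : 0 <= y := powR_ge0 _ _.
have yk : y ^+ k = x.
  by rewrite -powR_mulrn // -powRrM mulVf ?powRr1 // pnatr_eq0 -lt0n.
exists (Num.truncn y); have /andP[n_le n_gt] := truncn_itv y_ge0.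
rewrite natr1 n_gt andbT -yk.
by rewrite lerXn2r ?ltrXn2r ?nnegrE ?ler0n // -lt0n.
Qed.

(** If n^12 <= D < (n + 1)^12, then D^(1/12) / 2 <= (n + 1)/2 <= n, while
    sqrt D >= n^6 >= 64 (n + 2)^2 once n >= 4, so that n classes exist. *)
Lemma num_indecomposable_bound (R : realType) (eps : R) (D : nat) :
  0 < eps -> squarefree D -> (4 ^ 12 <= D)%N ->
  ((2^-1 * (D%:R : R) `^ (12^-1 - eps))%:E <= num_indecomposable R D)%E.
Proof.
move=> eps_gt0 sqD D_large.
have D_ge1 : 1 <= D%:R :> R by rewrite ler1n; apply: leq_trans D_large.
have [n /andP[/andP[n_le n_gt] root_lt]] := @powR_root_trunc R D%:R 12 (ler0n _ _) isT.
have n_ge4 : 4 <= n%:R :> R.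
  rewrite (ler_nat R 4) leqNgt; apply/negP => n_lt.
  have : D%:R < 4 ^+ 12 :> R.
    by apply: (lt_le_trans n_gt); rewrite lerXn2r ?nnegrE ?natr1 ?ler0n // (ler_nat R _ 4).
  by rewrite -(natrX R 4 12) ltr_nat ltnNge D_large.
have n6_le : n%:R ^+ 6 <= Num.sqrt (D%:R : R).
  by rewrite -ler_sqr ?nnegrE ?exprn_ge0 ?sqrtr_ge0 // sqr_sqrtr ?ler0n // -exprM.
apply: (le_trans _ (@num_indecomposable_ge R D n sqD _)).
  rewrite lee_fin; apply: (@le_trans _ _ (2^-1 * D%:R `^ 12^-1)); last by lra.
  by rewrite ler_wpM2l ?invr_ge0 // ler_powR //; lra.
apply: le_trans n6_le.
have n4 : 256 <= n%:R ^+ 4 :> R.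
  by rewrite (_ : 256 = 4 ^+ 4) ?lerXn2r ?nnegrE //; ring.
have n2 : 0 <= n%:R ^+ 2 :> R by rewrite exprn_ge0.
have n2_ge : n%:R + 2 <= 2 * n%:R :> R by lra.
rewrite (exprD _ 4 2).
apply: (@le_trans _ _ (256 * n%:R ^+ 2)); last by rewrite ler_wpM2r.
by nra.
Qed.

(** * From all large integers to natural density one *)

Lemma squarefree_count_unbounded (k : nat) : exists N0 : nat, forall N : nat,
  (N0 <= N)%N -> (k <= \sum_(1 <= n < N.+1 | squarefree n) 1)%N.
Proof.
elim: k => [|k [N0 IH]]; first by exists 0%N.
have [p p_gt p_prime] := prime_above N0; exists p => N N_ge.
rewrite (@big_cat_nat _ _ _ p) /=; [|by rewrite prime_gt0|by rewrite leqW].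
rewrite (@big_ltn_cond _ _ _ p) ?ltnS // squarefree_prime // addnA.
apply: leq_trans (leq_addr _ _); rewrite addn1 ltnS.
have -> : p = p.-1.+1 by rewrite prednK ?prime_gt0.
by apply: IH; rewrite -ltnS prednK ?prime_gt0.
Qed.

(** Only finitely many square-free integers fail the property, while the number
    of square-free integers up to N is unbounded. *)
Lemma almost_all_of_large (R : realType) (P : nat -> Prop) (D0 : nat) :
  (forall D : nat, squarefree D -> (D0 <= D)%N -> P D) -> almost_all_squarefree R P.
Proof.
move=> PD; apply/cvgrPdist_le => e e_gt0.
pose A N := (\sum_(1 <= n < N.+1 | squarefree n && `[< P n >]) 1)%N.
pose B N := (\sum_(1 <= n < N.+1 | squarefree n) 1)%N.
have AB N : (A N <= B N)%N.
  rewrite /A /B [leqRHS](bigID (fun n => `[< P n >])) /=; exact: leq_addr.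
have BA N : (B N <= A N + D0)%N.
  rewrite /A /B [leqLHS](bigID (fun n => `[< P n >])) /= leq_add2l.
  rewrite -big_filter sum1_size -[leqRHS](size_iota 0).
  apply: uniq_leq_size => [|n]; first by rewrite filter_uniq ?iota_uniq.
  rewrite mem_filter mem_iota leq0n add0n => /andP[/andP[sqn /asboolP nP] _].
  by rewrite ltnNge; apply/negP => /(PD n sqn).
have [k k_gt] : exists k : nat, D0%:R / e < k%:R.
  by exists (Num.truncn (D0%:R / e)).+1; apply: truncnS_gt.
have [N0 N0P] := squarefree_count_unbounded k.+1.
exists N0 => // N N_ge /=; have B_ge := N0P N N_ge.
rewrite -/(A N) -/(B N) -/(B N) in B_ge *.
have B_gt : k%:R < (B N)%:R :> R by rewrite ltr_nat.
have k_ge0 := ler0n R k.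
have ABR : (A N)%:R <= (B N)%:R :> R by rewrite ler_nat.
have BAR : (B N)%:R <= (A N)%:R + D0%:R :> R by rewrite -natrD ler_nat.
have B_pos : 0 < (B N)%:R :> R by lra.
have -> : 1 - (A N)%:R / (B N)%:R = ((B N)%:R - (A N)%:R) / (B N)%:R :> R.
  by rewrite mulrBl divff ?gt_eqF.
have BA_ge0 : 0 <= (B N)%:R - (A N)%:R :> R by rewrite subr_ge0.
rewrite ger0_norm ?(divr_ge0 BA_ge0 (ltW B_pos)) // ler_pdivrMr //.
apply: (@le_trans _ _ D0%:R); first by lra.
by rewrite mulrC -ler_pdivrMr // ltW // (lt_trans k_gt).
Qed.

Theorem theorem1p4 (R : realType) (eps : R) (eps_gt0 : 0 < eps) :
  almost_all_squarefree R (fun D : nat =>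
    ((2^-1 * (D%:R : R) `^ (12^-1 - eps))%:E <= num_indecomposable R D)%E).
Proof.
apply: (@almost_all_of_large R _ (4 ^ 12)) => D sqD D_large.
exact: num_indecomposable_bound.
Qed.
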